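(* Let $k\ge 3$ be an integer, let $G=(V,E)$ be a connected regular graph on vertex set $V=[k]^2$, and let $\lambda\in\mathbb{R}$, $\lambda\neq 0$, be the second-largest eigenvalue of the adjacency matrix of $G$. Then, for every real $d>0$ with $$d<\frac{4|E|}{k^3\lambda}\cdot\frac{(k-1)}{(k-2)}\log(k-1),$$ the function $\gamma_d$ defined on doubly stochastic $k\times k$ matrices $\mathbf{A}=(a_v)_{v\in[k]^2}$ by $$\gamma_d(\mathbf{A})=-\frac1k\sum_{v\in V(G)}a_v\log a_v+\frac d2\log\left(\frac{2\sum_{uv\in E(G)}a_ua_v}{k^2}\right)$$ has a unique maximum, attained at $\mathbf{A}=\frac1kJ_k$, with value $\gamma_d(\frac1kJ_k)=\log k+\frac d2\log\left(\frac{2|E|}{k^4}\right)$.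
   Context: $[k]=\{1,\dots,k\}$; $J_k$ is the $k\times k$ all-ones matrix. The entries of a $k\times k$ matrix are indexed by $[k]^2$, i.e. by the vertices of $G$. A doubly stochastic matrix has nonnegative entries with every row and column summing to $1$. The sum over $uv\in E(G)$ runs over undirected edges, each counted once. Conventions: $\log$ is the natural logarithm, $0\log 0=0$, and $\log 0=-\infty$. *)

(* Defs.v *)
From HB Require Import structures.
From mathcomp Require Import all_boot all_order all_algebra.
From mathcomp Require Import all_classical all_reals all_analysis.

Set Implicit Arguments.
Unset Strict Implicit.
Unset Printing Implicit Defensive.

Import Order.TTheory GRing.Theory Num.Theory.

Local Open Scope ring_scope.

Record sgraph (V : finType) := SGraph {
  adj :> rel V;
  adj_sym : symmetric adj;
  adj_irrefl : irreflexive adj }.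

Section Graphs.
Variables (V : finType) (G : sgraph V).

Definition connected_graph : Prop := forall u v : V, connect G u v.

Definition regular_graph : Prop :=
  exists r : nat, forall v : V, #|[set u | G v u]| = r.

(* An undirected edge uv is the two-element set [set u; v]. *)
Definition edges : {set {set V}} :=
  [set [set p.1; p.2] | p : V * V & G p.1 p.2].

(* Matrices are indexed by ordinals, so the vertices are numbered through
   [enum_val]; the spectrum does not depend on the numbering. *)
Definition adjacency_mx (R : nzRingType) : 'M[R]_#|V| :=
  \matrix_(i, j) (G (enum_val i) (enum_val j))%:R.

End Graphs.

(* Eigenvalues are counted with multiplicity: lam is lambda_2 in the list
   lambda_1 >= lambda_2 >= ... of roots of the characteristic polynomial. *)
Definition second_largest_eigenvalue (R : realFieldType) (n : nat)
    (M : 'M[R]_n) (lam : R) : Prop :=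
  exists s : seq R,
    [/\ sorted >=%R s, char_poly M = \prod_(x <- s) ('X - x%:P),
        (1 < size s)%N & s`_1 = lam].

Definition doubly_stochastic (R : realFieldType) (k : nat) : set 'M[R]_k :=
  [set A | [/\ forall i j, 0 <= A i j,
               forall i, \sum_j A i j = 1 &
               forall j, \sum_i A i j = 1]].
Arguments doubly_stochastic : clear implicits.

Section Gamma.
Variables (R : realType) (k : nat) (G : sgraph ('I_k * 'I_k)%type).

(* \sum_(uv in E(G)) a_u a_v *)
Definition edge_sum (A : 'M[R]_k) : R :=
  \sum_(e in edges G) \prod_(v in e) A v.1 v.2.

(* The first sum only needs 0 log 0 = 0, which the real-valued [ln] gives. The
   second logarithm is the extended [lne], with lne 0 = -oo. *)
Definition gamma (d : R) (A : 'M[R]_k) : \bar R :=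
  ((- k%:R^-1 * \sum_(v : 'I_k * 'I_k) A v.1 v.2 * ln (A v.1 v.2))%:E
   + (d / 2)%:E * lne (2 * edge_sum A / k%:R ^+ 2)%:E)%E.

End Gamma.

Definition unique_maximum_on (T : Type) (disp : Order.disp_t)
    (S : porderType disp) (D : set T) (f : T -> S) (x : T) : Prop :=
  [/\ D x, forall y, D y -> (f y <= f x)%O &
      forall y, D y -> f y = f x -> y = x].

(* Main.v *)
Require Import Defs.
From mathcomp Require Import all_boot all_order all_algebra.
From mathcomp Require Import all_classical all_reals all_analysis.
From mathcomp Require Import ring lra.

(** Write r for the degree of G, c = (k-1) ln(k-1) / (k-2), and S for the sum
    of the squares of the entries of a doubly stochastic A.  Since the entries
    of A sum to k, the number S - 1 is the squared Euclidean distance from A to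
    the flat matrix J/k, and both terms of gamma are controlled by it.

    - Spectral side: twice the edge sum is the quadratic form of the adjacency
      matrix at A, and is at most r + lam (S - 1) ([adj_form_le]).
    - Entropy side: sum a ln a + k ln k >= c (S - 1)
      ([neg_entropy_doubly_stochastic], which adds up [neg_entropy_ge_sqr] over
      the rows).

    With ln x <= x - 1 they give
      gamma(A) <= gamma(J/k) - (c/k - d lam / (2 r)) (S - 1),
    and as 2|E| = r k^2, the upper bound assumed on d says exactly that the
    coefficient of S - 1 is positive.  So J/k is the only maximiser.

    Entropy side.  For one row, that is for a probability vector p of length k,
    the constant c is optimal: equality holds at the uniform vector and also at
    ((k-1)/k, 1/(k(k-1)), ..., 1/(k(k-1))).  As y ln y - c y^2 changes convexity
    only once, no single affine function of y can support it at the three values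
    involved.  Instead the largest entry t is set apart, and the others are compared with their mean m = (1-t)/(k-1):
    [kl_ge_sqr] says that y ln y - c y^2 lies above its tangent at m for every
    value y that such an entry can take.  The vector may then be replaced by
    (t, m, ..., m), which leaves one variable.  There the function to bound is,
    up to a constant, t ln t + (1-t) ln (1-t) + K t (1-t), symmetric under
    t -> 1-t with two equal minima at 1/k and (k-1)/k ([tilted_entropy_ge]).
    All the inequalities between logarithms reduce to
    2(x-1)/(x+1) <= ln x <= (x^2-1)/(2x) for x >= 1.

    Spectral side.  On the hyperplane of functions with sum zero, the Rayleigh
    quotient of the adjacency matrix attains its maximum mu by compactness, and
    a maximiser is an eigenvector ([rayleigh_max]).  Connectedness forces mu < r
    ([adj_form_lt]); as r is itself an eigenvalue, mu is not the top of the
    spectrum, so mu <= lam ([adj_form_le_second]). *)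

Import Order.TTheory GRing.Theory Num.Theory.
Import numFieldNormedType.Exports.

Local Open Scope ring_scope.

Set Implicit Arguments.
Unset Strict Implicit.
Unset Printing Implicit Defensive.

(* Side conditions of field: each denominator is positive by linear arithmetic. *)
Ltac pos_neq0 := repeat (apply/andP; split); rewrite gt_eqF //; lra.

(** * Rational bounds on the logarithm *)

Lemma le_of_derive_ge0 (R : realType) (f df : R -> R) (a b : R) :
  a <= b ->
  (forall x, a <= x <= b -> is_derive x 1 f (df x)) ->
  (forall x, a <= x <= b -> 0 <= df x) ->
  f a <= f b.
Proof.
move=> le_ab dfE df_ge0.
have dfE_in x : x \in `]a, b[ -> is_derive x 1 f (df x).
  by rewrite in_itv /= => x_ab; apply: dfE; lra.
have f_cont : {within `[a, b], continuous f}%classic.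
  apply: derivable_within_continuous => x; rewrite in_itv /= => x_ab.
  by have [] := dfE x x_ab.
have [c c_ab fab] := MVT_segment le_ab dfE_in f_cont.
rewrite -subr_ge0 fab mulr_ge0 ?subr_ge0 //.
by apply: df_ge0; rewrite in_itv /= in c_ab.
Qed.

Lemma ln_le_subr1 (R : realType) (x : R) : 0 < x -> ln x <= x - 1.
Proof.
by move=> x_gt0; rewrite -{1}[x](subrKC 1) le_ln1Dx // ltrBrDl addrN.
Qed.

Lemma ln_ge_1subV (R : realType) (x : R) : 0 < x -> 1 - x^-1 <= ln x.
Proof.
move=> x_gt0; have := @ln_le_subr1 R x^-1; rewrite invr_gt0 lnV ?posrE //.
by move=> /(_ x_gt0); lra.
Qed.

(** The derivative of (x+1) ln x - 2(x-1) is ln x + 1/x - 1, which is nonnegative. *)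
Lemma ln_ge_pade (R : realType) (x : R) :
  1 <= x -> 2 * (x - 1) <= (x + 1) * ln x.
Proof.
move=> x_ge1.
pose f (y : R) := (y + 1) * ln y - 2 * (y - 1).
suff : f 1 <= f x by rewrite /f ln1; lra.
apply: (@le_of_derive_ge0 _ f (fun y => ln y + y^-1 - 1))
  => [|y y1x|y y1x]; first exact: x_ge1.
  have y_gt0 : 0 < y by lra.
  have y_neq0 := lt0r_neq0 y_gt0.
  have dln := is_derive1_ln y_gt0.
  rewrite /f; apply: is_derive_eq; rewrite /GRing.scale /=.
  by field.
by have := @ln_ge_1subV R y; lra.
Qed.

(** The derivative of x^2 - 1 - 2x ln x is 2(x - 1 - ln x), which is nonnegative. *)
Lemma ln_le_mean (R : realType) (x : R) :
  1 <= x -> 2 * x * ln x <= x ^+ 2 - 1.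
Proof.
move=> x_ge1.
pose f (y : R) := y ^+ 2 - 1 - 2 * (y * ln y).
suff : f 1 <= f x by rewrite /f ln1; lra.
apply: (@le_of_derive_ge0 _ f (fun y => 2 * (y - 1 - ln y)))
  => [|y y1x|y y1x]; first exact: x_ge1.
  have y_gt0 : 0 < y by lra.
  have y_neq0 := lt0r_neq0 y_gt0.
  have dln := is_derive1_ln y_gt0.
  rewrite /f; apply: is_derive_eq; rewrite /GRing.scale /=.
  by field.
by have := @ln_le_subr1 R y; lra.
Qed.

(** * The tangent inequality for the small entries of a row *)

(** The constant c of a row of length k is written u ln u / (u-1), with
    u = k-1.  The bound k/2 is the constant that the second order expansion of
    the entropy at the uniform vector would give. *)
Lemma logsob_cst_le (R : realType) (u : R) :
  1 < u -> u * ln u / (u - 1) <= (u + 1) / 2.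
Proof.
move=> u_gt1; rewrite ler_pdivrMr; last lra.
by have := @ln_le_mean R u; lra.
Qed.

(** The case y = s m, m = 1/(u+s) of the tangent inequality, for s >= 1.  Write
    ln u = ln s + ln (u/s): the right-hand side minus the left-hand side is then
    affine in these two logarithms, increasing in ln s, decreasing in ln (u/s).  Inserting the
    lower rational bound for the former and the upper one for the latter leaves
    a multiple of (s-1)^3 (u-s)^2. *)
Lemma kl_ge_sqr_ratio (R : realType) (u s : R) :
  1 < u -> 1 <= s <= u ->
  u * ln u / (u - 1) * (s - 1) ^+ 2 <= (u + s) * (s * ln s - s + 1).
Proof.
move=> u_gt1 /andP[s_ge1 s_leu].
have lnuE : ln u = ln s + ln (u / s).
  by rewrite ln_div ?posrE; lra.
have lo := @ln_ge_pade R s s_ge1.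
have hi : 2 * u * s * ln (u / s) <= u ^+ 2 - s ^+ 2.
  have s_gt0 : 0 < s by lra.
  have /ln_le_mean : 1 <= u / s by rewrite ler_pdivlMr // mul1r.
  rewrite -(ler_pM2r (_ : 0 < s ^+ 2)) ?exprn_gt0 //.
  suff -> : ((u / s) ^+ 2 - 1) * s ^+ 2 = u ^+ 2 - s ^+ 2.
    suff -> : 2 * (u / s) * ln (u / s) * s ^+ 2 = 2 * u * s * ln (u / s) by [].
    by set l := ln (u / s); field; rewrite lt0r_neq0.
  by field; rewrite lt0r_neq0.
rewrite mulrAC ler_pdivrMr; last lra.
rewrite lnuE; set a := ln s in lo *; set b := ln (u / s) in hi *.
pose P := (u - 1) * (u + s) * s - u * (s - 1) ^+ 2.
have P_ge0 : 0 <= P.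
  have : u * (s - 1) ^+ 2 <= (u + s) * ((u - 1) * s).
    rewrite expr2; apply: ler_pM => //; try lra.
      by rewrite mulr_ge0 //; lra.
    by apply: ler_pM; lra.
  by rewrite /P; lra.
have lo' : 0 <= 2 * s * P * ((s + 1) * a - 2 * (s - 1)).
  by rewrite !mulr_ge0 //; lra.
have hi' : 0 <= (s + 1) * (s - 1) ^+ 2 * (u ^+ 2 - s ^+ 2 - 2 * u * s * b).
  by rewrite !mulr_ge0 ?sqr_ge0 //; lra.
have rest : 0 <= (s - 1) ^+ 3 * (u - s) ^+ 2.
  by rewrite mulr_ge0 ?exprn_ge0 ?sqr_ge0 //; lra.
rewrite -subr_ge0 -(pmulr_rge0 _ (_ : 0 < 2 * s * (s + 1))); last first.
  by rewrite !mulr_gt0 //; lra.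
suff -> : 2 * s * (s + 1) *
    ((u + s) * (s * a - s + 1) * (u - 1) - u * (a + b) * (s - 1) ^+ 2)
  = 2 * s * P * ((s + 1) * a - 2 * (s - 1))
    + (s + 1) * (s - 1) ^+ 2 * (u ^+ 2 - s ^+ 2 - 2 * u * s * b)
    + (s - 1) ^+ 3 * (u - s) ^+ 2.
  by lra.
by rewrite /P; ring.
Qed.

(** The right-hand side is the gap between y ln y and its tangent at m.  In the
    application m is the mean of the entries other than the largest one, t, so
    that u m = 1 - t; the last three hypotheses then say that m <= 1/k, that
    y <= 1 - t and that y <= t.  Below m the bound c <= (u+1)/2 <= 1/(2m)
    suffices.  Above m, put s = y/m: the hypotheses give s <= u and
    m <= 1/(u+s), so the case treated in [kl_ge_sqr_ratio] is the worst one. *)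
Lemma kl_ge_sqr (R : realType) (u m y : R) :
  1 < u -> 0 < m -> 0 <= y -> (u + 1) * m <= 1 -> y <= u * m ->
  u * m + y <= 1 ->
  u * ln u / (u - 1) * (y - m) ^+ 2 <= y * ln (y / m) - y + m.
Proof.
move=> u_gt1 m_gt0 y_ge0 um_le1 y_leum umy_le1.
have m_neq0 := lt0r_neq0 m_gt0.
have c_gt0 : 0 <= u * ln u / (u - 1).
  by rewrite divr_ge0 ?mulr_ge0 ?ln_ge0 //; lra.
have [y_lem|m_lty] := lerP y m.
  apply: (@le_trans _ _ ((y - m) ^+ 2 / (2 * m))).
    rewrite mulrC ler_wpM2l ?sqr_ge0 // (le_trans (logsob_cst_le u_gt1)) //.
    rewrite -[X in _ <= X]mul1r ler_pdivlMr; last lra.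
    by lra.
  rewrite ler_pdivrMr; last lra.
  case: (eqVneq y 0) => [->|y_neq0].
    by rewrite mul0r; have := sqr_ge0 m; lra.
  have y_gt0 : 0 < y by rewrite lt_def y_neq0.
  have /ln_le_mean : 1 <= m / y by rewrite ler_pdivlMr // mul1r.
  have -> : ln (m / y) = - ln (y / m).
    by rewrite -lnV ?posrE ?divr_gt0 // invf_div.
  set l := ln (y / m).
  rewrite -(ler_pM2r (_ : 0 < y ^+ 2)) ?exprn_gt0 //.
  have -> : ((m / y) ^+ 2 - 1) * y ^+ 2 = m ^+ 2 - y ^+ 2 by field.
  have -> : 2 * (m / y) * - l * y ^+ 2 = - (2 * m * y * l) by field.
  by move=> h; rewrite -subr_ge0; lra.
have s_bnd : 1 <= y / m <= u by rewrite ler_pdivlMr // ler_pdivrMr //; lra.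
have := kl_ge_sqr_ratio u_gt1 s_bnd.
set l := ln (y / m); set c := u * ln u / (u - 1) => h.
have {h} : c * (y - m) ^+ 2 <= (u * m + y) * (y * l - y + m).
  rewrite -(ler_pM2r (_ : 0 < m ^+ 2)) ?exprn_gt0 // in h.
  suff -> : c * (y - m) ^+ 2 = c * (y / m - 1) ^+ 2 * m ^+ 2.
    suff -> : (u * m + y) * (y * l - y + m) =
      (u + y / m) * (y / m * l - y / m + 1) * m ^+ 2 by [].
    by field.
  by field.
move=> /le_trans; apply; rewrite -[X in _ <= X]mul1r.
rewrite ler_wpM2r //.
have y_gt0 : 0 < y by lra.
have := ln_ge_1subV (divr_gt0 y_gt0 m_gt0); rewrite invf_div -/l.
rewrite -(ler_pM2l y_gt0).
have -> : y * (1 - m / y) = y - m by field; rewrite lt0r_neq0.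
by lra.
Qed.

(** The same inequality up to m = 0, which forces y = 0:
    once the quotient y / m is expanded, both products vanish there. *)
Lemma kl_ge_sqr_closed (R : realType) (u m y : R) :
  1 < u -> 0 <= m -> 0 <= y -> (u + 1) * m <= 1 -> y <= u * m ->
  u * m + y <= 1 ->
  u * ln u / (u - 1) * (y - m) ^+ 2 <= y * ln y - y * ln m - y + m.
Proof.
move=> u_gt1 m_ge0 y_ge0 um_le1 y_leum umy_le1.
have [m_eq0|m_neq0] := eqVneq m 0.
  have -> : y = 0 by rewrite m_eq0 in y_leum; lra.
  by rewrite m_eq0 !mul0r !subr0 expr0n mulr0 addr0.
have m_gt0 : 0 < m by rewrite lt_def m_neq0.
apply: (le_trans (kl_ge_sqr u_gt1 m_gt0 y_ge0 um_le1 y_leum umy_le1)).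
have [->|y_neq0] := eqVneq y 0; first by rewrite !mul0r !subr0.
have y_gt0 : 0 < y by rewrite lt_def y_neq0.
by rewrite ln_div ?posrE // mulrBr.
Qed.

(** * The one-variable inequality *)

(** In other words ln z (z+1)/(z-1) is nondecreasing for z > 1.  Expanding
    ln u = ln z + ln (u/z) and inserting the rational bounds leaves
    2 (u-z)^2 (z-1)^2. *)
Lemma ln_slope_mono (R : realType) (u z : R) :
  1 <= z <= u -> (u - 1) * (z + 1) * ln z <= (u + 1) * (z - 1) * ln u.
Proof.
move=> /andP[z_ge1 z_leu].
have z_gt0 : 0 < z by lra.
have z_neq0 := lt0r_neq0 z_gt0.
have lnuE : ln u = ln z + ln (u / z) by rewrite ln_div ?posrE; lra.
have lo : 2 * (u - z) <= (u + z) * ln (u / z).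
  have /ln_ge_pade : 1 <= u / z by rewrite ler_pdivlMr // mul1r.
  rewrite -(ler_pM2r z_gt0); set l := ln (u / z).
  have -> : 2 * (u / z - 1) * z = 2 * (u - z) by field.
  by have -> : (u / z + 1) * l * z = (u + z) * l by field.
have hi := ln_le_mean z_ge1.
rewrite lnuE; set a := ln z in hi *; set b := ln (u / z) in lo *.
have lo' : 0 <= 2 * z * ((u + 1) * (z - 1)) * ((u + z) * b - 2 * (u - z)).
  by rewrite !mulr_ge0 //; lra.
have hi' : 0 <= 2 * (u - z) * (u + z) * (z ^+ 2 - 1 - 2 * z * a).
  by rewrite !mulr_ge0 //; lra.
have rest : 0 <= 2 * (u - z) ^+ 2 * (z - 1) ^+ 2.
  by rewrite -mulrA mulr_ge0 ?mulr_ge0 ?sqr_ge0 //; lra.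
rewrite -subr_ge0 -(pmulr_rge0 _ (_ : 0 < 2 * z * (u + z))); last first.
  by rewrite !mulr_gt0 //; lra.
suff -> : 2 * z * (u + z) *
    ((u + 1) * (z - 1) * (a + b) - (u - 1) * (z + 1) * a)
  = 2 * z * ((u + 1) * (z - 1)) * ((u + z) * b - 2 * (u - z))
    + 2 * (u - z) * (u + z) * (z ^+ 2 - 1 - 2 * z * a)
    + 2 * (u - z) ^+ 2 * (z - 1) ^+ 2.
  by lra.
by ring.
Qed.

(** The coefficient of t (1-t) is the one for which the critical points are 1/2,
    u/(u+1) and 1/(u+1). *)
Definition tilted_entropy (R : realType) (u t : R) : R :=
  t * ln t + (1 - t) * ln (1 - t) + (u + 1) / (u - 1) * ln u * (t * (1 - t)).

(** The value at the two wells 1/(u+1) and u/(u+1). *)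
Definition tilted_entropy_min (R : realType) (u : R) : R :=
  u ^+ 2 / (u ^+ 2 - 1) * ln u - ln (u + 1).

Lemma tilted_entropyE (R : realType) (u : R) :
  1 < u -> tilted_entropy u (u / (u + 1)) = tilted_entropy_min u.
Proof.
move=> u_gt1; rewrite /tilted_entropy /tilted_entropy_min.
have -> : 1 - u / (u + 1) = (u + 1)^-1 by field; pos_neq0.
rewrite ln_div ?posrE ?lnV ?posrE; try lra.
have u2_gt1 : 1 < u ^+ 2 by rewrite exprn_egt1.
set l := ln u; set n := ln (u + 1); field; pos_neq0.
Qed.

(** This is the bound at the endpoint t = 1, where the derivative is not defined:
    u^2 ln u <= (u^2-1) ln (u+1). *)
Lemma tilted_entropy_min_le0 (R : realType) (u : R) :
  1 < u -> tilted_entropy_min u <= 0.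
Proof.
move=> u_gt1; rewrite /tilted_entropy_min subr_le0.
have u_gt0 : 0 < u by lra.
have u2_gt1 : 1 < u ^+ 2 by rewrite exprn_egt1.
have lnE : ln (u + 1) = ln u + ln ((u + 1) / u) by rewrite ln_div ?posrE; lra.
have lo : 2 <= (2 * u + 1) * ln ((u + 1) / u).
  have /ln_ge_pade : 1 <= (u + 1) / u by rewrite ler_pdivlMr //; lra.
  rewrite -(ler_pM2r u_gt0); set l := ln ((u + 1) / u).
  have -> : 2 * ((u + 1) / u - 1) * u = 2 by field; pos_neq0.
  by have -> : ((u + 1) / u + 1) * l * u = (2 * u + 1) * l by field; pos_neq0.
have hi := ln_le_mean (ltW u_gt1).
rewrite mulrAC ler_pdivrMr; last lra.
rewrite lnE; set a := ln u in hi *; set b := ln ((u + 1) / u) in lo *.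
have a_ge0 : 0 <= a by rewrite ln_ge0 // ltW.
have b_ge0 : 0 <= b by rewrite ln_ge0 // ler_pdivlMr //; lra.
have ub : 1 <= 2 * u * b.
  by have : 0 <= (2 * u - 1) * b by [rewrite mulr_ge0 //; lra]; lra.
have : 0 <= (u ^+ 2 - 1 - 2 * u * a) * b by rewrite mulr_ge0 //; lra.
have : 0 <= a * (2 * u * b - 1) by rewrite mulr_ge0 //; lra.
by lra.
Qed.

Lemma tilted_entropy_sym (R : realType) (u t : R) :
  tilted_entropy u (1 - t) = tilted_entropy u t.
Proof. by rewrite /tilted_entropy subKr; ring. Qed.

Lemma is_derive_tilted_entropy (R : realType) (u t : R) : 0 < t < 1 ->
  is_derive t 1 (tilted_entropy u)
    (ln t - ln (1 - t) + (u + 1) / (u - 1) * ln u * (1 - 2 * t)).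
Proof.
move=> /andP[t_gt0 t_lt1].
have t'_gt0 : 0 < 1 - t by lra.
have dln := is_derive1_ln t_gt0.
have dln' : is_derive t 1 (fun x : R => ln (1 - x)) (- (1 - t)^-1).
  have dln1 := is_derive1_ln t'_gt0.
  have dsub : is_derive t 1 (fun x : R => 1 - x) (-1).
    by rewrite -[X in is_derive _ _ _ X]add0r; apply: is_deriveB.
  have := @is_derive1_comp R (@ln R) (fun x => 1 - x) t _ _ dln1 dsub.
  by rewrite mulrN1.
rewrite /tilted_entropy; apply: is_derive_eq; rewrite /GRing.scale /=.
set k := (u + 1) / (u - 1); set l := ln u; set p := ln t; set q := ln (1 - t).
by field; pos_neq0.
Qed.

(** In terms of the odds z = t/(1-t) the derivative has the sign of
    (u-1)(z+1) ln z - (u+1)(z-1) ln u, and [ln_slope_mono] determines it: for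
    t >= 1/2 the function decreases until z = u, that is t = u/(u+1), and
    increases afterwards. *)
Lemma tilted_entropy_ge_half (R : realType) (u t : R) :
  1 < u -> 1 / 2 <= t <= 1 -> tilted_entropy_min u <= tilted_entropy u t.
Proof.
move=> u_gt1 /andP[t_ge t_le1].
have [->|t_neq1] := eqVneq t 1.
  rewrite /tilted_entropy ln1 subrr !(mulr0, mul0r, addr0).
  exact: tilted_entropy_min_le0.
have t_lt1 : t < 1 by rewrite lt_def eq_sym t_neq1.
rewrite -tilted_entropyE //; set s := u / (u + 1).
have s_lt1 : s < 1 by rewrite ltr_pdivrMr; lra.
have s_ge : 1 / 2 <= s by rewrite ler_pdivlMr; lra.
have sE : (1 - s) * u = s by rewrite /s; field; pos_neq0.
have slopeE (x : R) : 0 < x < 1 ->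
    ln x - ln (1 - x) + (u + 1) / (u - 1) * ln u * (1 - 2 * x)
    = (1 - x) / (u - 1) * ((u - 1) * (x / (1 - x) + 1) * ln (x / (1 - x))
                           - (u + 1) * (x / (1 - x) - 1) * ln u).
  move=> x01; rewrite ln_div ?posrE; [|lra|lra].
  set l := ln u; set p := ln x; set q := ln (1 - x).
  by field; pos_neq0.
have oddsE (x : R) : 1 / 2 <= x < 1 -> 1 <= x / (1 - x).
  by move=> x_bnd; rewrite ler_pdivlMr; lra.
have [t_les|s_ltt] := lerP t s.
  rewrite -lerN2.
  apply: (@le_of_derive_ge0 _ (fun x => - tilted_entropy u x)
    (fun x => - (ln x - ln (1 - x) + (u + 1) / (u - 1) * ln u * (1 - 2 * x))))
    => [|x x_bnd|x x_bnd]; first exact: t_les.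
    apply: is_deriveN; apply: is_derive_tilted_entropy; lra.
  have z_ge1 : 1 <= x / (1 - x) by apply: oddsE; lra.
  have z_leu : x / (1 - x) <= u.
    rewrite ler_pdivrMr; last lra.
    have : (1 - s) * u <= (1 - x) * u by rewrite ler_wpM2r; lra.
    by lra.
  rewrite oppr_ge0 slopeE; last lra.
  rewrite pmulr_rle0 ?subr_le0; last by rewrite divr_gt0; lra.
  by rewrite ln_slope_mono // z_ge1.
apply: (@le_of_derive_ge0 _ (tilted_entropy u)
    (fun x => ln x - ln (1 - x) + (u + 1) / (u - 1) * ln u * (1 - 2 * x)))
    => [|x x_bnd|x x_bnd]; first exact: ltW.
  by apply: is_derive_tilted_entropy; lra.
have u_lez : u <= x / (1 - x).
  rewrite ler_pdivlMr; last lra.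
  have : (1 - x) * u <= (1 - s) * u by rewrite ler_wpM2r; lra.
  by lra.
rewrite slopeE; last lra.
rewrite pmulr_rge0 ?subr_ge0; last by rewrite divr_gt0; lra.
set z := x / (1 - x) in u_lez *.
have := @ln_slope_mono R z u; rewrite u_lez (ltW u_gt1) => /(_ isT).
by rewrite [(z + 1) * _]mulrC [(z - 1) * _]mulrC.
Qed.

Lemma tilted_entropy_ge (R : realType) (u t : R) :
  1 < u -> 0 <= t <= 1 -> tilted_entropy_min u <= tilted_entropy u t.
Proof.
move=> u_gt1 t01; have [t_ge|t_lt] := lerP (1 / 2) t.
  by apply: tilted_entropy_ge_half => //; lra.
by rewrite -tilted_entropy_sym tilted_entropy_ge_half //; lra.
Qed.

(** * Entropy of a probability vector *)

(** The left-hand factor is the squared distance from p to the uniform vector,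
    the right-hand side its relative entropy.  Replacing all entries but the
    largest by their mean does not increase the right-hand side minus the
    left-hand side, by [kl_ge_sqr_closed]; what remains is [tilted_entropy_ge]. *)
Lemma neg_entropy_ge_sqr (R : realType) (I : finType) (k : R) (p : I -> R) :
  k = #|I|%:R -> (2 < #|I|)%N -> (forall i, 0 <= p i) -> \sum_i p i = 1 ->
  (k - 1) * ln (k - 1) / (k - 2) * (\sum_i p i ^+ 2 - k^-1)
    <= \sum_i p i * ln (p i) + ln k.
Proof.
move=> k_card I_gt2 p_ge0 p_sum1; pose u := k - 1.
have k_ge3 : 3 <= k by rewrite k_card ler_nat.
have u_gt1 : 1 < u by rewrite /u; lra.
have kE : k = u + 1 by rewrite /u; ring.
have [j0 _] : exists j : I, j \in I by apply/card_gt0P; apply: leq_trans I_gt2.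
have [i0 _ p_max] := @arg_maxP _ R I j0 xpredT p isT.
set t := p i0; pose m := (1 - t) / u.
have umE : u * m = 1 - t by rewrite /m; field; pos_neq0.
have sum_rest : \sum_(i | i != i0) p i = u * m.
  by rewrite umE; move: p_sum1; rewrite (bigD1 i0) //= -/t; lra.
have card_rest : \sum_(i | i != i0) (1 : R) = u.
  rewrite sumr_const /u k_card; have := cardC1 i0.
  rewrite (eq_card (B := predC1 i0)) // => ->.
  by rewrite -[in RHS](prednK (ltnW (ltnW I_gt2))) -natr1 addrK.
have t_ge : 1 <= k * t.
  rewrite -p_sum1 k_card mulr_natl -sumr_const ler_sum // => i _; exact: p_max.
have t_le1 : t <= 1.
  by rewrite -subr_ge0 -umE -sum_rest sumr_ge0.
have m_ge0 : 0 <= m by rewrite /m divr_ge0; lra.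
have um_le1 : (u + 1) * m <= 1.
  rewrite /m mulrA ler_pdivrMr; last lra.
  by rewrite -kE; lra.
have rest_le i : i != i0 ->
    u * ln u / (u - 1) * (p i - m) ^+ 2
      <= p i * ln (p i) - p i * ln m - p i + m.
  move=> i_neq; apply: kl_ge_sqr_closed => //.
    rewrite -sum_rest (bigD1 i) //= lerDl.
    by apply: sumr_ge0.
  by have : p i <= t by [exact: p_max]; rewrite umE; lra.
have := ler_sum (P := fun i => i != i0) (index_enum I) rest_le.
rewrite -mulr_sumr.
have -> : \sum_(i | i != i0) (p i - m) ^+ 2
    = \sum_(i | i != i0) p i ^+ 2 - u * m ^+ 2.
  transitivity (\sum_(i | i != i0) (p i ^+ 2 + (p i * (- 2 * m) + 1 * m ^+ 2))).
    by apply: eq_bigr => i _; ring.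
  by rewrite !big_split /= -!mulr_suml sum_rest card_rest; ring.
have -> : \sum_(i | i != i0) (p i * ln (p i) - p i * ln m - p i + m)
    = \sum_(i | i != i0) p i * ln (p i) - u * m * ln m.
  transitivity (\sum_(i | i != i0) (p i * ln (p i)
    + (p i * (- ln m - 1) + 1 * m))).
    by apply: eq_bigr => i _; ring.
  by rewrite !big_split /= -!mulr_suml sum_rest card_rest; ring.
set S := \sum_(i | i != i0) p i ^+ 2; set H := \sum_(i | i != i0) p i * ln (p i).
have -> : \sum_i p i ^+ 2 = t ^+ 2 + S by rewrite (bigD1 i0).
have -> : \sum_i p i * ln (p i) = t * ln t + H by rewrite (bigD1 i0).
have tilt : tilted_entropy_min u <= tilted_entropy u t.
  by apply: tilted_entropy_ge => //; rewrite t_le1 p_ge0.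
have lnumE : (1 - t) * ln (1 - t) = u * m * (ln u + ln m).
  rewrite -umE; have [->|m_neq0] := eqVneq m 0; first by rewrite mulr0 !mul0r.
  by rewrite lnM ?posrE // ?lt_def ?m_neq0 //; lra.
move: tilt; rewrite /tilted_entropy_min /tilted_entropy lnumE -kE.
have -> : k - 2 = u - 1 by rewrite /u; ring.
rewrite -/u.
have tE : t = 1 - u * m by rewrite umE; ring.
have u2_gt1 : 1 < u ^+ 2 by rewrite exprn_egt1.
(* For the vector (t, m, ..., m) the right-hand side minus the left-hand side
   is exactly tilted_entropy u t - tilted_entropy_min u. *)
have balance : u * ln u / (u - 1) * (t ^+ 2 + u * m ^+ 2 - k^-1)
  = u ^+ 2 / (u ^+ 2 - 1) * ln u - u * m * ln u
    - k / (u - 1) * ln u * (t * (1 - t)).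
  rewrite tE kE; set l := ln u; field; pos_neq0.
rewrite kE in balance *.
move: balance; set c := u * ln u / (u - 1); set d := u ^+ 2 / (u ^+ 2 - 1) * ln u.
set e := (u + 1) / (u - 1) * ln u * _; set b := ln u; set a := ln m.
set f := ln (u + 1); set g := t * ln t; set h := (u + 1)^-1.
by lra.
Qed.

(** * The Rayleigh quotient on an invariant hyperplane *)

Lemma continuous_sumr (R : realType) (T : topologicalType) (I : finType)
    (f : I -> T -> R) :
  (forall i, continuous (f i)) -> continuous (fun x => \sum_i f i x).
Proof.
move=> f_cont x; apply: cvg_big => [|i _]; first exact: add_continuous.
exact: f_cont.
Qed.

Lemma continuous_mulr (R : realType) (T : topologicalType) (f g : T -> R) :
  continuous f -> continuous g -> continuous (fun x => f x * g x).
Proof.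
by move=> f_cont g_cont x; apply: continuousM; [exact: f_cont|exact: g_cont].
Qed.

Definition dotv (R : realType) (n : nat) (u v : 'rV[R]_n) : R :=
  (u *m v^T) 0 0.

Section DotProduct.
Context {R : realType} {n : nat}.
Implicit Types u v w : 'rV[R]_n.

Lemma dotvE u v : dotv u v = \sum_i u 0 i * v 0 i.
Proof. by rewrite /dotv mxE; apply: eq_bigr => i _; rewrite mxE. Qed.

Lemma dotvC u v : dotv u v = dotv v u.
Proof. by rewrite !dotvE; apply: eq_bigr => i _; rewrite mulrC. Qed.

Lemma dotvDl u v w : dotv (u + v) w = dotv u w + dotv v w.
Proof. by rewrite /dotv mulmxDl mxE. Qed.

Lemma dotvZl a u v : dotv (a *: u) v = a * dotv u v.
Proof. by rewrite /dotv -scalemxAl mxE. Qed.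

Lemma dotvDr u v w : dotv u (v + w) = dotv u v + dotv u w.
Proof. by rewrite dotvC dotvDl !(dotvC u). Qed.

Lemma dotvZr a u v : dotv u (a *: v) = a * dotv u v.
Proof. by rewrite dotvC dotvZl (dotvC u). Qed.

Lemma dotvv_ge0 u : 0 <= dotv u u.
Proof. by rewrite dotvE sumr_ge0 // => i _; rewrite -expr2 sqr_ge0. Qed.

Lemma dotvv_eq0 u : (dotv u u == 0) = (u == 0).
Proof.
apply/eqP/eqP => [u0|->]; last by rewrite dotvE big1 // => i _; rewrite !mxE mul0r.
apply/rowP => i; rewrite mxE; apply/eqP; rewrite -sqrf_eq0.
move/eqP: u0; rewrite dotvE psumr_eq0 => [|j _]; last by rewrite -expr2 sqr_ge0.
by move=> /allP /(_ i); rewrite mem_index_enum -expr2 => /(_ isT).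
Qed.

Lemma dotv_sym (M : 'M[R]_n) u v :
  M^T = M -> dotv (u *m M) v = dotv u (v *m M).
Proof. by move=> M_sym; rewrite /dotv trmx_mul M_sym mulmxA. Qed.

Lemma continuous_dotv_mulmx (A : 'M[R]_n) : continuous (fun v => dotv (v *m A) v).
Proof.
have -> : (fun v => dotv (v *m A) v) =
    fun v => \sum_j (\sum_i v 0 i * A i j) * v 0 j.
  by apply/funext => v; rewrite dotvE; apply: eq_bigr => j _; rewrite mxE.
apply: continuous_sumr => j; apply: continuous_mulr; last exact: coord_continuous.
apply: continuous_sumr => i; apply: continuous_mulr; first exact: coord_continuous.
exact: cst_continuous.
Qed.

Lemma continuous_dotvl w : continuous (fun v => dotv v w).
Proof.
have -> : (fun v => dotv v w) = fun v => \sum_i v 0 i * w 0 i.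
  by apply/funext => v; rewrite dotvE.
apply: continuous_sumr => i; apply: continuous_mulr; first exact: coord_continuous.
exact: cst_continuous.
Qed.

Lemma compact_sphere_hyperplane w :
  compact [set v | dotv v v = 1 /\ dotv v w = 0]%classic.
Proof.
apply: bounded_closed_compact.
  exists 1; split; first exact: num_real.
  move=> b b_gt1 v /= [v_unit _]; apply: le_trans (ltW b_gt1).
  rewrite [leLHS]/Num.norm /= mx_normrE; apply/bigmax_leP; split=> // -[i j] _ /=.
  rewrite ord1 -(@expr_le1 _ 2) // -normrX ger0_norm ?sqr_ge0 //.
  rewrite -v_unit dotvE (bigD1 j) //= expr2 lerDl sumr_ge0 // => k _.
  by rewrite -expr2 sqr_ge0.
have -> : [set v | dotv v v = 1 /\ dotv v w = 0]%classic =
    ((fun v => dotv (v *m 1%:M) v) @^-1` [set x | x = 1] `&`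
     (fun v => dotv v w) @^-1` [set x | x = 0])%classic.
  by apply/seteqP; split=> v /=; rewrite mulmx1.
apply: closedI.
  by have /continuous_closedP := @continuous_dotv_mulmx 1%:M; apply; exact: closed_eq.
by have /continuous_closedP := @continuous_dotvl w; apply; exact: closed_eq.
Qed.

(** The hyperplane orthogonal to an eigenvector e is stable under the symmetric
    matrix M.  If v maximises the quotient there, with value mu, then
    x = mu v - v M belongs to the hyperplane, and the form
    mu |w|^2 - w M w^T, nonnegative there and zero at v, has derivative 2 |x|^2
    at v in the direction x; hence x = 0. *)
Lemma rayleigh_max (M : 'M[R]_n) (e : 'rV[R]_n) (r : R) :
  M^T = M -> e *m M = r *: e -> (exists2 w : 'rV_n, w != 0 & dotv w e = 0) ->
  exists mu : R, exists2 v, [/\ v != 0, dotv v e = 0 & v *m M = mu *: v] &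
    forall w, dotv w e = 0 -> dotv (w *m M) w <= mu * dotv w w.
Proof.
move=> M_sym eM [w0 w0_neq0 w0_e].
pose S := [set v : 'rV[R]_n | dotv v v = 1 /\ dotv v e = 0]%classic.
have normalize w : w != 0 -> dotv w e = 0 ->
    exists2 s : R, s != 0 & S (s *: w).
  move=> w_neq0 w_e; exists (Num.sqrt (dotv w w))^-1.
    by rewrite invr_neq0 // sqrtr_eq0 -ltNge lt_def dotvv_eq0 w_neq0 dotvv_ge0.
  split; last by rewrite dotvZl w_e mulr0.
  rewrite dotvZl dotvZr mulrA -expr2 exprVn sqr_sqrtr ?dotvv_ge0 //.
  by rewrite mulVf ?dotvv_eq0.
have S_neq0 : (S !=set0)%classic.
  by have [s _ Ssw] := normalize w0 w0_neq0 w0_e; exists (s *: w0).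
have [|v] := compact_EVT_max S_neq0 (@compact_sphere_hyperplane e)
    (f := fun v => dotv (v *m M) v).
  by apply: continuous_subspaceT; exact: continuous_dotv_mulmx.
rewrite inE => -[v_unit v_e] v_max.
set mu := dotv (v *m M) v in v_max.
have ray w : dotv w e = 0 -> dotv (w *m M) w <= mu * dotv w w.
  move=> w_e; have [->|w_neq0] := eqVneq w 0.
    by rewrite mul0mx (eqP (_ : dotv 0 0 == 0)) ?dotvv_eq0 // mulr0.
  have [s s_neq0 Ssw] := normalize w w_neq0 w_e.
  have := v_max (s *: w); rewrite inE => /(_ Ssw).
  case: Ssw => + _; rewrite -scalemxAl !dotvZl !dotvZr => sw_unit.
  have s2_gt0 : 0 < s * s by rewrite -expr2 lt_def sqrf_eq0 s_neq0 sqr_ge0.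
  move=> le_mu; rewrite -(ler_pM2l s2_gt0).
  have -> : s * s * (mu * dotv w w) = mu * (s * (s * dotv w w)) by ring.
  by rewrite sw_unit mulr1 -mulrA.
exists mu, v => //; split=> //.
  by rewrite -dotvv_eq0 v_unit oner_eq0.
have [x x_def] : exists x, x = mu *: v - v *m M by exists (mu *: v - v *m M).
have xE w : dotv x w = mu * dotv v w - dotv (v *m M) w.
  by rewrite x_def dotvDl dotvZl -scaleN1r dotvZl mulN1r.
have x_e : dotv x e = 0.
  by rewrite xE dotv_sym // eM dotvZr v_e !mulr0 subr0.
pose b := dotv x x; pose c := mu * b - dotv (x *m M) x.
have c_ge0 : 0 <= c by rewrite subr_ge0 ray.
have quad s : 0 <= 2 * s * b + s ^+ 2 * c.
  have := ray (v + s *: x); rewrite dotvDl dotvZl v_e x_e mulr0 addr0.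
  move=> /(_ erefl); rewrite mulmxDl -scalemxAl.
  rewrite !(dotvDl, dotvDr, dotvZl, dotvZr) -/mu v_unit (dotvC x v).
  have := xE x; rewrite -/b => bE.
  rewrite (dotv_sym x v M_sym) (dotvC x (v *m M)) /c.
  set p := dotv v x in bE *; set q := dotv (v *m M) x in bE *.
  by set y := dotv (x *m M) x; rewrite bE; lra.
have b_ge0 : 0 <= b by exact: dotvv_ge0.
have : b == 0.
  (* A negative step, small enough for the linear term to dominate. *)
  have := quad (- b / (c + 1)).
  rewrite -(pmulr_rge0 _ (_ : 0 < (c + 1) ^+ 2)); last first.
    by rewrite exprn_gt0 //; lra.
  have -> : (c + 1) ^+ 2 * (2 * (- b / (c + 1)) * b + (- b / (c + 1)) ^+ 2 * c)
      = - (b ^+ 2 * (c + 2)) by field; pos_neq0.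
  rewrite oppr_ge0 pmulr_lle0; last lra.
  by rewrite -sqrf_eq0 eq_le sqr_ge0 andbT.
by rewrite dotvv_eq0 x_def subr_eq0 => /eqP ->.
Qed.

End DotProduct.

(** * The adjacency form of a regular connected graph *)

Lemma sorted_ge_second (R : realFieldType) (s : seq R) (a b : R) :
  sorted >=%R s -> a \in s -> b \in s -> a < b -> a <= s`_1.
Proof.
case: s => [|s0 [|s1 s]] //=; first by rewrite !inE => _ /eqP-> /eqP->; rewrite ltxx.
move=> /andP[s1_le s1_path] a_in b_in a_ltb.
have s_path : path >=%R s0 (s1 :: s) by rewrite /= s1_le.
have b_le : b <= s0.
  move: b_in; rewrite inE => /orP[/eqP->//|b_in].
  by have /allP := order_path_min (rev_trans le_trans) s_path; apply.
move: a_in; rewrite inE => /orP[/eqP a_s0|]; first by lra.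
rewrite inE => /orP[/eqP->//|a_in].
by have /allP := order_path_min (rev_trans le_trans) s1_path; apply.
Qed.

Section GraphForms.
Context {R : realType} {V : finType} (G : sgraph V).
Implicit Types f g : V -> R.

(** The sum runs over ordered pairs, so that each edge counts twice. *)
Definition adj_form f : R := \sum_(p : V * V | G p.1 p.2) f p.1 * f p.2.

(** An edge is the image of exactly two ordered pairs because a loopless graph
    has no edge reduced to one vertex. *)
Lemma sum_edges f :
  adj_form f = 2 * \sum_(e in edges G) \prod_(v in e) f v.
Proof.
rewrite /adj_form mulr_sumr.
rewrite (partition_big (fun p => [set p.1; p.2]) [in edges G]) /=; last first.
  by move=> p Gp; apply/imsetP; exists p; rewrite ?inE.
apply: eq_bigr => e /imsetP[[u v]]; rewrite inE /= => Guv ->.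
have u_neq_v : u != v.
  by apply: contraTneq Guv => ->; rewrite adj_irrefl.
rewrite big_setU1 ?inE //= big_set1.
rewrite (bigD1 (u, v)) /=; last by rewrite Guv eqxx.
rewrite (big_pred1 (v, u)) /= => [|[x y]]; first by ring.
rewrite /= !xpair_eqE; apply/idP/idP => [/andP[/andP[Gxy /eqP exy] xy_neq]|].
  have : x \in [set u; v] by rewrite -exy !inE eqxx.
  have : y \in [set u; v] by rewrite -exy !inE eqxx orbT.
  have x_neq_y : x != y by apply: contraTneq Gxy => ->; rewrite adj_irrefl.
  rewrite !inE => /orP[]/eqP y_eq /orP[]/eqP x_eq;
    by move: x_neq_y xy_neq; rewrite x_eq y_eq !eqxx.
move=> /andP[/eqP-> /eqP->]; rewrite adj_sym Guv finset.setUC eqxx /=.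
by rewrite eq_sym (negbTE u_neq_v).
Qed.

Definition rowv f : 'rV[R]_#|V| := \row_i f (enum_val i).

Lemma sum_enum_val f : \sum_(i < #|V|) f (enum_val i) = \sum_v f v.
Proof. by rewrite [RHS](reindex _ (onW_bij _ (@enum_val_bij V))). Qed.

Lemma dotv_rowv f g : dotv (rowv f) (rowv g) = \sum_v f v * g v.
Proof.
by rewrite dotvE -sum_enum_val; apply: eq_bigr => i _; rewrite !mxE.
Qed.

Lemma rowv_mul_adjacency f :
  rowv f *m adjacency_mx G R = rowv (fun v => \sum_(u | G u v) f u).
Proof.
apply/rowP => j; rewrite !mxE [RHS]big_mkcond -sum_enum_val.
by apply: eq_bigr => i _; rewrite !mxE; case: ifP; rewrite ?mulr1 ?mulr0.
Qed.

Lemma rowv_surj (w : 'rV[R]_#|V|) : {f | w = rowv f}.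
Proof.
by exists (fun v => w 0 (enum_rank v)); apply/rowP => i; rewrite mxE enum_valK.
Qed.

Lemma rowv_eq0 f : (rowv f == 0) -> forall v, f v = 0.
Proof.
by move=> /eqP/rowP f0 v; have := f0 (enum_rank v); rewrite !mxE enum_rankK.
Qed.

Lemma adj_form_mx f :
  adj_form f = dotv (rowv f *m adjacency_mx G R) (rowv f).
Proof.
rewrite rowv_mul_adjacency dotv_rowv /adj_form.
rewrite -(pair_big_dep xpredT (fun u v => G u v) (fun u v => f u * f v)) /=.
rewrite (exchange_big_dep xpredT) //=.
by apply: eq_bigr => v _; rewrite mulr_suml.
Qed.

Lemma adjacency_mx_sym : (adjacency_mx G R)^T = adjacency_mx G R.
Proof. by apply/matrixP => i j; rewrite !mxE adj_sym. Qed.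

Section Regular.
Variable r : nat.
Hypothesis G_reg : forall v : V, #|[set u | G v u]%SET| = r.

Lemma sum_nbrs_const (v : V) (a : R) : \sum_(u | G v u) a = r%:R * a.
Proof.
rewrite sumr_const -(G_reg v) mulr_natl; congr (_ *+ _).
by apply: eq_card => u; rewrite inE.
Qed.

Lemma sum_adj_fst f : \sum_(p : V * V | G p.1 p.2) f p.1 = r%:R * \sum_v f v.
Proof.
rewrite -(pair_big_dep xpredT (fun u v => G u v) (fun u v => f u)) /=.
by rewrite mulr_sumr; apply: eq_bigr => u _; rewrite sum_nbrs_const.
Qed.

Lemma sum_adj_snd f : \sum_(p : V * V | G p.1 p.2) f p.2 = r%:R * \sum_v f v.
Proof.
have swap_inj : injective (fun p : V * V => (p.2, p.1)).
  by move=> [a b] [c d] [-> ->].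
rewrite -sum_adj_fst (reindex_inj swap_inj) /=.
by apply: eq_bigl => p; rewrite adj_sym.
Qed.

Lemma adj_form_shift f (c : R) :
  adj_form (fun v => f v + c)
    = adj_form f + 2 * c * r%:R * \sum_v f v + c ^+ 2 * r%:R * #|V|%:R.
Proof.
transitivity (\sum_(p : V * V | G p.1 p.2)
    (f p.1 * f p.2 + (c * f p.1 + (c * f p.2 + c ^+ 2 * 1)))).
  by apply: eq_bigr => p _; ring.
rewrite !big_split /= -!mulr_sumr sum_adj_fst sum_adj_snd.
have := sum_adj_fst (fun=> 1); rewrite /= -/(adj_form f) => ->.
by rewrite sumr_const -mulr_natl (eq_card (B := V)) //; ring.
Qed.

Lemma dirichlet_form f :
  \sum_(p : V * V | G p.1 p.2) (f p.1 - f p.2) ^+ 2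
    = 2 * (r%:R * \sum_v f v ^+ 2 - adj_form f).
Proof.
transitivity (\sum_(p : V * V | G p.1 p.2)
    (f p.1 ^+ 2 + (f p.2 ^+ 2 + (- 2) * (f p.1 * f p.2)))).
  by apply: eq_bigr => p _; ring.
rewrite !big_split /= -!mulr_sumr -/(adj_form f).
have := sum_adj_fst (fun v => f v ^+ 2); have := sum_adj_snd (fun v => f v ^+ 2).
by move=> /= -> ->; ring.
Qed.

Hypothesis G_conn : connected_graph G.

(** If equality held, the Dirichlet form would vanish, so f would be constant
    along edges, hence constant, hence zero. *)
Lemma adj_form_lt f :
  \sum_v f v = 0 -> (exists v, f v != 0) ->
  adj_form f < r%:R * \sum_v f v ^+ 2.
Proof.
move=> f_sum0 [v fv_neq0]; rewrite -subr_gt0 lt_def.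
have diri_ge0 : 0 <= \sum_(p : V * V | G p.1 p.2) (f p.1 - f p.2) ^+ 2.
  by apply: sumr_ge0 => p _; exact: sqr_ge0.
rewrite dirichlet_form pmulr_rge0 // in diri_ge0; rewrite diri_ge0 andbT.
apply/eqP => diri0.
have /eqP := dirichlet_form f; rewrite diri0 mulr0 psumr_eq0; last first.
  by move=> p _; exact: sqr_ge0.
move=> /allP nbr_eq.
have f_adj (x y : V) : G x y -> f x = f y.
  move=> Gxy; have := nbr_eq (x, y); rewrite mem_index_enum => /(_ isT) /=.
  by rewrite Gxy sqrf_eq0 subr_eq0 => /eqP.
have f_const x : f x = f v.
  have /connectP[s s_path ->] := G_conn v x.
  elim: s v s_path {fv_neq0} => //= y s IHs v /andP[/f_adj-> s_path].
  exact: IHs.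
have : \sum_(x : V) f x = #|V|%:R * f v.
  by rewrite (eq_bigr _ (fun x _ => f_const x)) sumr_const mulr_natl.
move/eqP; rewrite f_sum0 eq_sym mulf_eq0 (negbTE fv_neq0) orbF pnatr_eq0.
by move=> /eqP/card0_eq/(_ v).
Qed.

(** The maximum mu of the Rayleigh quotient on functions with sum zero is an
    eigenvalue below r, which is an eigenvalue too; in the decreasing list of
    eigenvalues it therefore comes at position 1 or later. *)
Lemma adj_form_le_second lam f :
  second_largest_eigenvalue (adjacency_mx G R) lam -> \sum_v f v = 0 ->
  adj_form f <= lam * \sum_v f v ^+ 2.
Proof.
move=> [s [s_sorted charE _ <-]] f_sum0.
have sqE g : \sum_v g v ^+ 2 = dotv (rowv g) (rowv g).
  by rewrite dotv_rowv; apply: eq_bigr => v _; rewrite expr2.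
have dot1 g : dotv (rowv g) (rowv (fun=> 1)) = \sum_v g v.
  by rewrite dotv_rowv; apply: eq_bigr => v _; rewrite mulr1.
rewrite adj_form_mx sqE.
have [->|f_neq0] := eqVneq (rowv f) 0.
  by rewrite mul0mx (eqP (_ : dotv 0 0 == 0)) ?dotvv_eq0 ?mulr0.
have one_eigen : rowv (fun=> 1) *m adjacency_mx G R = r%:R *: rowv (fun=> 1).
  rewrite rowv_mul_adjacency; apply/rowP => i; rewrite !mxE.
  by under eq_bigl do rewrite adj_sym; rewrite sum_nbrs_const.
have in_spectrum (a : R) (w : 'rV_#|V|) :
    w != 0 -> w *m adjacency_mx G R = a *: w -> a \in s.
  move=> w_neq0 w_eigen; rewrite -root_prod_XsubC -charE -eigenvalue_root_char.
  by apply/eigenvalueP; exists w.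
have perp_ex : exists2 w : 'rV[R]_#|V|, w != 0 & dotv w (rowv (fun=> 1)) = 0.
  by exists (rowv f) => //; rewrite dot1.
have [mu [v [v_neq0 v_1 v_eigen] ray]] :=
  rayleigh_max adjacency_mx_sym one_eigen perp_ex.
apply: le_trans (ray (rowv f) _) _; first by rewrite dot1.
apply: ler_wpM2r; first exact: dotvv_ge0.
have [g vE] := rowv_surj v.
rewrite {v}vE in v_neq0 v_1 v_eigen; rewrite dot1 in v_1.
have [x gx_neq0] : exists x, g x != 0.
  apply/existsP; apply: contraNT v_neq0 => /existsPn g0.
  by apply/eqP/rowP => i; rewrite !mxE; apply/eqP/negbNE/g0.
apply: sorted_ge_second s_sorted (in_spectrum _ _ v_neq0 v_eigen) _ _.
  apply: in_spectrum one_eigen; apply: contraTneq isT => one0.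
  by have := rowv_eq0 (introT eqP one0) x => /eqP; rewrite oner_eq0.
have := adj_form_lt v_1 (ex_intro _ x gx_neq0).
rewrite adj_form_mx v_eigen dotvZl sqE ltr_pM2r //.
by rewrite lt_def dotvv_eq0 v_neq0 dotvv_ge0.
Qed.

(** Split f into its mean and a function with sum zero; regularity makes the two
    parts orthogonal for the form. *)
Lemma adj_form_le lam f :
  second_largest_eigenvalue (adjacency_mx G R) lam -> (0 < #|V|)%N ->
  adj_form f <= lam * (\sum_v f v ^+ 2 - (\sum_v f v) ^+ 2 / #|V|%:R)
    + r%:R * ((\sum_v f v) ^+ 2 / #|V|%:R).
Proof.
move=> lam_second V_gt0; set n : R := #|V|%:R; set t := \sum_v f v.
have n_neq0 : n != 0 by rewrite pnatr_eq0 -lt0n.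
pose g v := f v - t / n.
have sum_cst (c : R) : \sum_(v : V) c = n * c by rewrite sumr_const mulr_natl.
have g_sum0 : \sum_v g v = 0.
  by rewrite big_split /= sum_cst -/t; field.
have g_sqr : \sum_v g v ^+ 2 = \sum_v f v ^+ 2 - t ^+ 2 / n.
  transitivity (\sum_v (f v ^+ 2 + ((- 2 * (t / n)) * f v + (t / n) ^+ 2))).
    by apply: eq_bigr => v _; rewrite /g; ring.
  by rewrite !big_split /= -mulr_sumr sum_cst -/t; field.
have -> : adj_form f = adj_form (fun v => g v + t / n).
  by congr adj_form; apply/funext => v; rewrite subrK.
have := adj_form_le_second lam_second g_sum0.
rewrite g_sqr adj_form_shift g_sum0.
set S := \sum_v f v ^+ 2; set A := adj_form g.
suff -> : (t / n) ^+ 2 * r%:R * #|V|%:R = r%:R * (t ^+ 2 / n) by lra.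
by rewrite -/n; field.
Qed.

End Regular.
End GraphForms.

(** * Doubly stochastic matrices *)

Section DoublyStochastic.
Context {R : realType} {k : nat}.
Implicit Type A : 'M[R]_k.

Lemma sum_doubly_stochastic A :
  doubly_stochastic R k A -> \sum_(v : 'I_k * 'I_k) A v.1 v.2 = k%:R.
Proof.
move=> [_ A_row _]; rewrite -(pair_bigA _ (fun i j => A i j)) /=.
by rewrite (eq_bigr _ (fun i _ => A_row i)) sumr_const card_ord.
Qed.

Lemma sum_sqr_dist_flat A : (0 < k)%N -> doubly_stochastic R k A ->
  \sum_(v : 'I_k * 'I_k) (A v.1 v.2 - k%:R^-1) ^+ 2
    = \sum_(v : 'I_k * 'I_k) A v.1 v.2 ^+ 2 - 1.
Proof.
move=> k_gt0 A_ds; have k_neq0 : k%:R != 0 :> R by rewrite pnatr_eq0 -lt0n.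
transitivity (\sum_(v : 'I_k * 'I_k) (A v.1 v.2 ^+ 2
    + ((- 2 / k%:R) * A v.1 v.2 + (k%:R^-1) ^+ 2))).
  by apply: eq_bigr => v _; ring.
rewrite !big_split /= -mulr_sumr sum_doubly_stochastic // sumr_const.
rewrite card_prod card_ord -[_ *+ (k * k)]mulr_natl natrM.
by field.
Qed.

Lemma neg_entropy_doubly_stochastic A : (2 < k)%N -> doubly_stochastic R k A ->
  (k%:R - 1) * ln (k%:R - 1) / (k%:R - 2)
      * (\sum_(v : 'I_k * 'I_k) A v.1 v.2 ^+ 2 - 1)
    <= \sum_(v : 'I_k * 'I_k) A v.1 v.2 * ln (A v.1 v.2) + k%:R * ln k%:R.
Proof.
move=> k_gt2 [A_ge0 A_row _]; set K : R := k%:R; set c := _ / (K - 2).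
have K_neq0 : K != 0 by rewrite pnatr_eq0 -lt0n (leq_trans _ k_gt2).
rewrite -(pair_bigA _ (fun i j => A i j ^+ 2)) /=.
rewrite -(pair_bigA _ (fun i j => A i j * ln (A i j))) /=.
have row_le i : c * (\sum_j A i j ^+ 2 - K^-1) <= \sum_j A i j * ln (A i j) + ln K.
  by apply: neg_entropy_ge_sqr; rewrite ?card_ord.
have := ler_sum (P := xpredT) (index_enum 'I_k) (fun i _ => row_le i).
have sum_cst (x : R) : \sum_(i < k) x = K * x.
  by rewrite sumr_const card_ord mulr_natl.
by rewrite -mulr_sumr !big_split /= !sum_cst mulrN mulfV.
Qed.

End DoublyStochastic.

Section FlatMatrix.
Context {R : realType} {k : nat} (G : sgraph ('I_k * 'I_k)%type).

Lemma edge_sumE (A : 'M[R]_k) :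
  2 * edge_sum G A = adj_form G (fun v => A v.1 v.2).
Proof. by rewrite sum_edges. Qed.

Lemma card_edges_adj_form : 2 * #|edges G|%:R = adj_form G (fun=> 1) :> R.
Proof.
rewrite sum_edges; congr (_ * _); rewrite -sum1_card natr_sum.
by apply: eq_bigr => e _; rewrite big1.
Qed.

Lemma edge_sum_flat :
  2 * edge_sum G (const_mx k%:R^-1) = 2 * #|edges G|%:R / k%:R ^+ 2 :> R.
Proof.
rewrite edge_sumE card_edges_adj_form /adj_form mulr_suml.
by apply: eq_bigr => p _; rewrite !mxE !mul1r -expr2 exprVn.
Qed.

Lemma gamma_flat (d : R) : (0 < k)%N -> (0 < #|edges G|)%N ->
  gamma G d (const_mx k%:R^-1)
    = (ln k%:R + d / 2 * ln (2 * #|edges G|%:R / k%:R ^+ 4))%:E.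
Proof.
move=> k_gt0 E_gt0.
have K_gt0 : 0 < k%:R :> R by rewrite ltr0n.
have E_gt0' : 0 < #|edges G|%:R :> R by rewrite ltr0n.
have K_neq0 := lt0r_neq0 K_gt0.
rewrite /gamma edge_sum_flat.
have -> : 2 * #|edges G|%:R / k%:R ^+ 2 / k%:R ^+ 2
    = 2 * #|edges G|%:R / k%:R ^+ 4 :> R by field.
rewrite lne_EFin; last by rewrite divr_gt0 ?exprn_gt0 ?mulr_gt0.
rewrite -EFinM -EFinD; congr (_ + _)%:E.
under eq_bigr do rewrite mxE lnV ?posrE //.
rewrite sumr_const card_prod card_ord -[_ *+ (k * k)]mulr_natl natrM.
by set l := ln _; field.
Qed.

End FlatMatrix.

Unset Implicit Arguments.

Theorem proposition1p4 (R : realType) (k : nat) (hk : (3 <= k)%N)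
    (G : sgraph ('I_k * 'I_k)%type)
    (hconn : connected_graph G) (hreg : regular_graph G)
    (lam : R)
    (hlam : second_largest_eigenvalue (adjacency_mx G R) lam)
    (lam_neq0 : lam != 0)
    (d : R) (d_gt0 : 0 < d)
    (hd : d < 4 * #|edges G|%:R / (k%:R ^+ 3 * lam)
              * ((k%:R - 1) / (k%:R - 2)) * ln (k%:R - 1)) :
  unique_maximum_on (doubly_stochastic R k) (gamma G d) (const_mx k%:R^-1)
  /\ gamma G d (const_mx k%:R^-1)
     = (ln k%:R + d / 2 * ln (2 * #|edges G|%:R / k%:R ^+ 4))%:E.
Proof.
have k_gt0 : (0 < k)%N by apply: leq_trans hk.
set K : R := k%:R in hd *.
have K_ge3 : 3 <= K by rewrite /K ler_nat.
have K_neq0 : K != 0 by rewrite gt_eqF //; lra.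
have lnK1_gt0 : 0 < ln (K - 1) by apply: ln_gt0; lra.
have cst_gt0 : 0 < (K - 1) / (K - 2) * ln (K - 1).
  by rewrite mulr_gt0 // divr_gt0; lra.
(* As d is positive, its upper bound is positive as well: this gives both an
   edge and the sign of lam. *)
have hd' : 0 < 4 * #|edges G|%:R / (K ^+ 3 * lam).
  by rewrite -(pmulr_lgt0 _ cst_gt0) mulrA (lt_trans d_gt0).
have E_gt0 : (0 < #|edges G|)%N.
  by rewrite lt0n; apply: contraTneq hd' => ->; rewrite mulr0 mul0r ltxx.
have lam_gt0 : 0 < lam.
  rewrite -invr_gt0 -(pmulr_rgt0 _ (_ : 0 < 4 * #|edges G|%:R / K ^+ 3)).
    by rewrite invfM mulrA in hd'.
  by rewrite divr_gt0 ?mulr_gt0 ?ltr0n ?exprn_gt0 //; lra.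
have val := gamma_flat d k_gt0 E_gt0; rewrite -/K in val.
split=> //.
have [r G_reg] := hreg.
have card_V : #|{: 'I_k * 'I_k}|%:R = K ^+ 2 :> R.
  by rewrite card_prod card_ord natrM expr2.
have E_r : 2 * #|edges G|%:R = r%:R * K ^+ 2 :> R.
  rewrite card_edges_adj_form /adj_form; under eq_bigr do rewrite mulr1.
  by rewrite (sum_adj_fst G_reg (fun=> 1)) sumr_const card_V.
have r_gt0 : 0 < r%:R :> R.
  rewrite -(pmulr_lgt0 _ (_ : 0 < K ^+ 2)) ?exprn_gt0 //; last lra.
  by rewrite -E_r mulr_gt0 ?ltr0n.
set eta := (K - 1) * ln (K - 1) / (K - 2) / K - d * lam / (2 * r%:R).
have eta_gt0 : 0 < eta.
  rewrite subr_gt0 ltr_pdivrMr; last by rewrite mulr_gt0.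
  have -> : (K - 1) * ln (K - 1) / (K - 2) / K * (2 * r%:R) =
      4 * #|edges G|%:R / (K ^+ 3 * lam)
        * ((K - 1) / (K - 2)) * ln (K - 1) * lam.
    have -> : 4 * #|edges G|%:R = 2 * (2 * #|edges G|%:R) :> R by ring.
    rewrite E_r; set l := ln (K - 1); field.
    by rewrite K_neq0 lam_neq0 gt_eqF //; lra.
  by rewrite ltr_pM2r.
have gap A : doubly_stochastic R k A -> 0 < edge_sum G A ->
    (gamma G d A <= (ln K + d / 2 * ln (2 * #|edges G|%:R / K ^+ 4)
      - eta * \sum_(v : 'I_k * 'I_k) (A v.1 v.2 - K^-1) ^+ 2)%:E)%E.
  move=> A_ds A_gt0.
  have P_gt0 : 0 < 2 * edge_sum G A by rewrite mulr_gt0.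
  rewrite /gamma -/K lne_EFin; last by rewrite divr_gt0 ?exprn_gt0 //; lra.
  rewrite -EFinM -EFinD lee_fin sum_sqr_dist_flat //.
  have ent := neg_entropy_doubly_stochastic hk A_ds; rewrite -/K in ent.
  have := adj_form_le G_reg hconn (fun v => A v.1 v.2) hlam.
  rewrite -edge_sumE card_V sum_doubly_stochastic // card_prod card_ord.
  rewrite muln_gt0 k_gt0 => /(_ isT); rewrite -/K divff ?expf_neq0 // mulr1.
  move: ent; set S := \sum_v _ ^+ 2; set N := \sum_v _ * ln _.
  set P := 2 * edge_sum G A in P_gt0 *; set c := _ / (K - 2) => ent P_le.
  have -> : 2 * #|edges G|%:R / K ^+ 4 = r%:R / K ^+ 2 :> R.
    by rewrite E_r; field.
  (* r / K^2 is the value at the flat matrix; only the ratio P / r matters. *)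
  have -> : P / K ^+ 2 = P / r%:R * (r%:R / K ^+ 2) by field; rewrite K_neq0 lt0r_neq0.
  have Pr_gt0 : 0 < P / r%:R by rewrite divr_gt0.
  rewrite lnM ?posrE //; last by rewrite divr_gt0 ?exprn_gt0 //; lra.
  have ln_le : ln (P / r%:R) <= lam * (S - 1) / r%:R.
    apply: le_trans (ln_le_subr1 Pr_gt0) _.
    rewrite ler_pdivlMr // mulrBl mul1r divfK ?lt0r_neq0 //.
    by lra.
  have entK : c / K * (S - 1) <= K^-1 * N + ln K.
    rewrite -(ler_pM2l (_ : 0 < K)); last lra.
    have -> : K * (c / K * (S - 1)) = c * (S - 1) by field.
    by have -> : K * (K^-1 * N + ln K) = N + K * ln K by set l := ln K; field.
  have d2_ge0 : 0 <= d / 2 by lra.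
  have := ler_wpM2l d2_ge0 ln_le.
  have -> : d / 2 * (lam * (S - 1) / r%:R) = d * lam / (2 * r%:R) * (S - 1).
    by field; rewrite lt0r_neq0.
  rewrite /eta -/c; move: entK; set x := c / K; set y := d * lam / _.
  set l := ln (P / _); set l' := ln (_ / K ^+ 2); set lK := ln K.
  by lra.
have sqr_ge (A : 'M[R]_k) :
    0 <= \sum_(v : 'I_k * 'I_k) (A v.1 v.2 - K^-1) ^+ 2.
  by apply: sumr_ge0 => v _; exact: sqr_ge0.
have edge_sum_cases A : doubly_stochastic R k A ->
    edge_sum G A = 0 \/ 0 < edge_sum G A.
  move=> [A_ge0 _ _]; have [A0|A_neq0] := eqVneq (edge_sum G A) 0; first by left.
  right; rewrite lt_def A_neq0.
  by apply: sumr_ge0 => e _; apply: prodr_ge0.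
have gammaNy A : edge_sum G A = 0 -> gamma G d A = -oo%E.
  move=> A0; rewrite /gamma A0 mulr0 mul0r le0_lneNy //.
  by rewrite mulr_infty gtr0_sg ?mul1e //; lra.
split=> [|A A_ds|A A_ds]; rewrite ?val.
- split=> [i j|i|j]; first by rewrite mxE invr_ge0 ler0n.
    by under eq_bigr do rewrite mxE; rewrite sumr_const card_ord -mulr_natl mulfV.
  by under eq_bigr do rewrite mxE; rewrite sumr_const card_ord -mulr_natl mulfV.
- have [A0|A_gt0] := edge_sum_cases A A_ds.
    by rewrite gammaNy // leNye.
  apply: le_trans (gap A A_ds A_gt0) _.
  by rewrite lee_fin gerBl mulr_ge0 // ltW.
have [A0|A_gt0] := edge_sum_cases A A_ds.
  by rewrite gammaNy.
move=> gamma_eq; have := gap A A_ds A_gt0; rewrite gamma_eq lee_fin.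
rewrite lerDl oppr_ge0 pmulr_rle0 // => sum_le0.
have /eqP := le_anti (introT andP (conj sum_le0 (sqr_ge A))).
rewrite psumr_eq0 => [/allP A_flat|v _]; last exact: sqr_ge0.
apply/matrixP => i j; rewrite mxE; apply/eqP; rewrite -subr_eq0 -sqrf_eq0.
by have := A_flat (i, j); rewrite mem_index_enum => /(_ isT).
Qed.
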